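(* There exists a (strictly) stationary sequence $\{X_j\}$ of real random variables which admits a continuous phantom distribution function, has the extremal index $\theta=0$ and is non-ergodic.
   Context: $M_n=\max_{1\le j\le n}X_j$ and $F(x)=\mathbb{P}(X_1\le x)$. A distribution function $G$ is a phantom distribution function for the stationary sequence $\{X_j\}$ if $\sup_{u\in\mathbb{R}}|\mathbb{P}(M_n\le u)-G^n(u)|\to 0$ as $n\to\infty$, where $G^n(u)=(G(u))^n$. The sequence $\{X_j\}$ has the extremal index $\theta=0$ if $\mathbb{P}(M_n\le u_n(\tau))\to 1$ whenever $\{u_n(\tau)\}$ is a real sequence such that $n(1-F(u_n(\tau)))\to\tau\in(0,+\infty)$. *)

(* Defs.v *)
From HB Require Import structures.
From mathcomp Require Export all_boot all_order all_algebra.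
From mathcomp Require Export all_classical all_reals all_analysis.
Export Order.TTheory GRing.Theory Num.Theory.
Export numFieldNormedType.Exports.

Set Implicit Arguments.
Unset Strict Implicit.
Unset Printing Implicit Defensive.

Local Open Scope classical_set_scope.
Local Open Scope ring_scope.

(* The product sigma-algebra of R^nat, generated by the one-dimensional
   cylinders {x | x j \in B}, B Borel. *)
Definition path_measurable (R : realType) (A : set (nat -> R)) : Prop :=
  <<s [set C | exists j (B : set R),
         measurable B /\ C = [set x : nat -> R | B (x j)]] >> A.

Definition path_shift (R : realType) (x : nat -> R) : nat -> R := fun j => x j.+1.

(* A sequence X_1, X_2, ... is indexed from 0: [X j] stands for X_(j+1). *)
Section sequences_of_random_variables.
Context d (T : measurableType d) (R : realType) (P : probability T R).
Implicit Types (X : nat -> {RV P >-> R}).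

Definition sample_path X (w : T) : nat -> R := fun j => X j w.

Definition path_law X (A : set (nat -> R)) : \bar R := P (sample_path X @^-1` A).

Definition stationary X : Prop :=
  forall A, path_measurable A -> path_law X (@path_shift R @^-1` A) = path_law X A.

Definition ergodic X : Prop :=
  forall A, path_measurable A -> @path_shift R @^-1` A = A ->
    path_law X A = 0%E \/ path_law X A = 1%E.

(* Since R has no least element, [X 0 w] serves as initial value: this is
   max(X_1, ..., X_n) for n >= 1, and a junk value for n = 0. *)
Definition partial_max X (n : nat) (w : T) : R :=
  \big[Num.max/X 0 w]_(j < n) X j w.

Definition max_cdf X (n : nat) (u : R) : R :=
  fine (P [set w | partial_max X n w <= u]).

(* Distribution functions on R are the elements of [cumulativeBounded 0 1]:
   nondecreasing, right-continuous, with limits 0 at -oo and 1 at +oo. *)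
Definition phantom_distribution_function X
    (G : cumulativeBounded (0 : R) (1 : R)) : Prop :=
  sup [set `|max_cdf X n u - G u ^+ n| | u in [set: R]] @[n --> \oo] --> (0 : R).

Definition extremal_index_zero X : Prop :=
  forall (tau : R) (u : nat -> R), 0 < tau ->
    n%:R * (1 - fine (cdf (X 0) (u n))) @[n --> \oo] --> tau ->
    max_cdf X n (u n) @[n --> \oo] --> (1 : R).

End sequences_of_random_variables.

(* Main.v *)
From HB Require Import structures.
Require Import Defs.
From mathcomp Require Import ring lra zify measurable_realfun.

(** Let Z_0, Z_1, ... be the Luroth digits of a uniform point of ]0, 1]: they are
    i.i.d. with P(Z_i > q) = 1/(q + 2).  Draw once and for all a window length
    V = Z_0^2 + 1 and set X_j = max(Z_{j+1}, ..., Z_{j+V}).  Given V, the maximum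
    M_n is the maximum of n + V - 1 of the digits, and V is asymptotically
    irrelevant against n, so M_n has the same phantom as the i.i.d. digits.  But
    V has infinite mean, so the tail of X_0 is much heavier than that of a digit:
    this forces the extremal index 0.  Since V is invariant, shifting X_j by 1/2
    unless Z_0 = 0 leaves the extremes unchanged and makes the event {Z_0 = 0}, of
    probability 1/2, readable from any tail of the path. *)

Set Implicit Arguments.
Unset Strict Implicit.
Unset Printing Implicit Defensive.
Local Open Scope classical_set_scope.
Local Open Scope ring_scope.

(** * The Luroth map on ]0, 1] and the measure of its cylinders *)

Section luroth.
Context {R : realType}.
Implicit Types (x : R) (A : set R).

Let mI : measurable (`]0, 1]%classic : set (measurableTypeR R)).
Proof. exact: measurable_itv. Qed.

Definition unif01 : set (measurableTypeR R) -> \bar R :=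
  mrestr (@lebesgue_measure R) mI.

HB.instance Definition _ := Measure.on unif01.

Let unif01_setT : unif01 setT = 1%E.
Proof.
rewrite /unif01 /mrestr setTI lebesgue_measure_itv/= lte_fin ltr01.
by rewrite oppr0 adde0.
Qed.

HB.instance Definition _ :=
  Measure_isProbability.Build _ _ _ unif01 unif01_setT.

(** Digits are counted from 0. Truncation gives the junk digit 0 to every point outside ]0, 1]. *)
Definition luroth_digit x : nat := (Num.truncn x^-1).-1.

(* On the branch [luroth_digit x = k], i.e. 1/(k+2) < x <= 1/(k+1), this is the
   increasing affine bijection onto ]0, 1]. *)
Definition luroth_map x : R :=
  (luroth_digit x).+1%:R * ((luroth_digit x).+2%:R * x - 1).

Lemma luroth_digit_ge q x :
  (q.+1 <= luroth_digit x)%N = (0 < x <= q.+2%:R^-1).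
Proof.
rewrite /luroth_digit ltn_predRL truncn_gt_nat.
have q0 : 0 < q.+2%:R :> R by rewrite ltr0n.
have [x0|x0]/= := ltP 0 x.
  by rewrite -[in RHS](invrK x) lef_pV2 ?posrE ?invr_gt0.
by apply/negbTE; rewrite -ltNge (le_lt_trans _ q0)// invr_le0.
Qed.

Lemma measurable_luroth_digit :
  measurable_fun [set: measurableTypeR R] luroth_digit.
Proof.
move=> _; apply: (measurability _ NGenCInfty.measurableE) => //.
move=> /= _ [_ [q ->] <-]; rewrite setTI.
rewrite [X in measurable X](_ : _ = [set x | (q <= luroth_digit x)%N]); last first.
  by apply/seteqP; split => x /=; rewrite in_itv/= andbT.
case: q => [|q]; first by rewrite (_ : [set x | _] = setT)//; exact/seteqP.
rewrite (_ : [set x | _] = `]0, q.+2%:R^-1]%classic); first exact: measurable_itv.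
by apply/seteqP; split => x /=; rewrite luroth_digit_ge in_itv.
Qed.

Lemma measurable_luroth_map :
  measurable_fun [set: measurableTypeR R] (luroth_map : _ -> measurableTypeR R).
Proof.
have mZ (f : nat -> R) :
    measurable_fun [set: measurableTypeR R] (fun x => f (luroth_digit x)).
  have mf : measurable_fun [set: nat] f by [].
  exact: (measurableT_comp mf measurable_luroth_digit).
apply: measurable_funM; first exact: (mZ (fun k => k.+1%:R)).
apply: measurable_funB => //; apply: measurable_funM => //.
exact: (mZ (fun k => k.+2%:R)).
Qed.

Lemma luroth_branch k x : 0 < x <= 1 ->
  (luroth_digit x == k) = (k.+2%:R^-1 < x <= k.+1%:R^-1).
Proof.
move=> /andP[x0 x1]; rewrite eqn_leq leqNgt luroth_digit_ge x0/= -ltNge.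
by case: k => [|k]; rewrite ?luroth_digit_ge ?x0 // invr1 x1.
Qed.

(** On branch [k] the map is affine of slope (k+1)(k+2), so it divides the length of the preimage of
    an interval by that slope. *)
Lemma luroth_cylinder_ray k b :
  unif01 (luroth_digit @^-1` [set k] `&` luroth_map @^-1` `]b, +oo[) =
  ((k.+1 * k.+2)%:R^-1%:E * unif01 `]b, +oo[)%E.
Proof.
(* The branch takes its values in ]0, 1], so the ray may be cut at 0. *)
set b' := Num.max b 0.
have k1 : 0 < k.+1%:R :> R by [].
have k2 : 0 < k.+2%:R :> R by [].
(* [c] is the point that the affine branch [k] sends to [b']. *)
set c : R := (b' + k.+1%:R) / (k.+1 * k.+2)%:R.
have eqA : luroth_digit @^-1` [set k] `&` luroth_map @^-1` `]b, +oo[ `&` `]0, 1]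
    = `]c, k.+1%:R^-1]%classic :> set R.
  apply/seteqP; split => x /=; rewrite !in_itv/= ?andbT.
    move=> [[kx bx] x01]; move/eqP: (kx); rewrite luroth_branch//.
    move=> /andP[x1 ->]; rewrite andbT ltr_pdivrMr ?ltr0n// natrM.
    rewrite -ltrBrDr gt_max; apply/andP; split.
      by move: bx; rewrite /luroth_map kx; nra.
    by move: x1; rewrite -[_^-1]mul1r ltr_pdivrMr//; nra.
  rewrite ltr_pdivrMr ?ltr0n// natrM -ltrBrDr gt_max => /andP[/andP[bx x0] x1].
  have kx0 : k.+2%:R^-1 < x by rewrite -[_^-1]mul1r ltr_pdivrMr//; nra.
  have x01 : 0 < x <= 1.
    rewrite (lt_trans _ kx0) ?invr_gt0//= (le_trans x1)// invf_le1//.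
    by rewrite ler1n.
  have kx : luroth_digit x = k.
    by apply/eqP; rewrite luroth_branch// kx0.
  by split => //; split => //; rewrite /luroth_map kx; move: bx; nra.
have eqB : `]b, +oo[ `&` `]0, 1] = `]b', 1]%classic :> set R.
  apply/seteqP; split => x /=; rewrite !in_itv/= andbT gt_max.
    by move=> [-> /andP[-> ->]].
  by move=> /andP[/andP[-> ->] ->].
rewrite /unif01 /mrestr eqA eqB !lebesgue_measure_itv/= !lte_fin.
have -> : (c < k.+1%:R^-1) = (b' < 1).
  rewrite ltr_pdivrMr ?ltr0n// natrM mulKf ?gt_eqF// -(natr1 k.+1).
  by rewrite addrC ltrD2l.
case: ifPn => _; last by rewrite mule0.
rewrite -!EFinB -EFinM; congr EFin; rewrite /c natrM -(natr1 k.+1).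
by field; rewrite !gt_eqF //; lra.
Qed.

(** The open rays are stable under intersection, generate the Borel sets and exhaust the line. *)
Lemma measure_unique_rays (m1 m2 : {measure set (measurableTypeR R) -> \bar R}) :
  (m1 setT < +oo)%E -> (forall b, m1 `]b, +oo[%classic = m2 `]b, +oo[%classic) ->
  forall A, measurable (A : set (measurableTypeR R)) -> m1 A = m2 A.
Proof.
move=> m1oo m12 A mA.
refine (@measure_unique _ R (measurableTypeR R) (@RGenOInfty.G R)
  (fun n => `](- n%:R), +oo[%classic) _ _ _ _ m1 m2 _ _ A mA) => //.
- exact: RGenOInfty.measurableE.
- move=> _ _ [a ->] [b ->]; exists (Num.max a b).
  by apply/seteqP; split => x /=; rewrite !in_itv/= !andbT gt_max => /andP.
- by move=> n; exists (- n%:R).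
- apply/seteqP; split => // x _; exists (Num.truncn `|x|).+1 => //=.
  by rewrite in_itv/= andbT ltrNl (le_lt_trans _ (truncnS_gt _))// -normrN ler_norm.
- by move=> _ [b ->]; exact: m12.
- by move=> n; apply: le_lt_trans m1oo; rewrite le_measure ?inE.
Qed.

(** This product form says that the first digit is independent of the image point, which is again
    uniform. The independence of all the digits follows by iterating it. *)
Lemma luroth_cylinder k A : measurable (A : set (measurableTypeR R)) ->
  unif01 (luroth_digit @^-1` [set k] `&` luroth_map @^-1` A) =
  ((k.+1 * k.+2)%:R^-1%:E * unif01 A)%E.
Proof.
have mk : measurable (luroth_digit @^-1` [set k] : set (measurableTypeR R)).
  by rewrite -[X in measurable X]setTI; exact: measurable_luroth_digit.
have c0 : 0 <= (k.+1 * k.+2)%:R^-1 :> R by rewrite invr_ge0.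
(* Both sides are read as measures in [A], so that agreement on rays suffices. *)
rewrite setIC -[LHS]/(pushforward (mrestr unif01 mk)
  (luroth_map : _ -> measurableTypeR R) A) -[RHS]/(mscale (NngNum c0) unif01 A).
move=> mA; apply: measure_unique_rays mA.
- exact: measurable_luroth_map.
- move=> mT; rewrite /= /pushforward /mrestr preimage_setT setTI.
  by rewrite (le_lt_trans (probability_le1 _ _)) ?ltry.
- by move=> mT b; rewrite /= /pushforward /mrestr setIC luroth_cylinder_ray.
Qed.

End luroth.

(** * Invariance of the uniform law, independence of the digits, and window maxima *)

Section iid.
Context {R : realType}.
Local Notation Omega := (measurableTypeR R).
Implicit Types (x : R) (A B : set Omega).
Local Notation Z := (@luroth_digit R).
Local Notation T := (@luroth_map R).
Local Notation mu := (@unif01 R).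

Lemma measurable_preimage_digit (C : set nat) : measurable (Z @^-1` C : set Omega).
Proof. by rewrite -[X in measurable X]setTI; exact: measurable_luroth_digit. Qed.

Lemma measurable_preimage_map A :
  measurable A -> measurable (T @^-1` A : set Omega).
Proof.
by move=> mA; rewrite -[X in measurable X]setTI; exact: measurable_luroth_map.
Qed.

Lemma unif01_slices A : measurable A ->
  mu A = (\sum_(0 <= k <oo) mu (Z @^-1` [set k] `&` A))%E.
Proof.
move=> mA.
rewrite [in LHS](_ : A = \bigcup_k (Z @^-1` [set k] `&` A)); last first.
  by rewrite -setI_bigcupl -preimage_bigcup bigcup_imset1 image_id preimage_setT setTI.
rewrite measure_bigcup//.
- by apply: eq_eseriesl => k; rewrite in_setT.
- by move=> k _; apply: measurableI => //; exact: measurable_preimage_digit.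
- by move=> i j _ _ [x [[/= <- _] [<- _]]].
Qed.

Lemma luroth_map_invariant A : measurable A -> mu (T @^-1` A) = mu A.
Proof.
have cyl B : measurable B ->
    mu (T @^-1` B) = ((\sum_(0 <= k <oo) (k.+1 * k.+2)%:R^-1%:E) * mu B)%E.
  move=> mB; rewrite unif01_slices; last exact: measurable_preimage_map.
  under eq_eseriesr do rewrite luroth_cylinder//.
  have mBfin : mu B \is a fin_num by rewrite fin_num_measure.
  rewrite -(fineK mBfin) [RHS]muleC -nneseriesZl.
    by apply: eq_eseriesr => k _; rewrite muleC.
  by move=> k _; rewrite lee_fin invr_ge0.
(* The sum of the branch masses is never computed: the case of the full set shows that it is 1. *)
have := cyl setT measurableT.
rewrite preimage_setT probability_setT mule1 => sum1 /cyl ->.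
by rewrite -sum1 mul1e.
Qed.

(** The branch masses telescope: 1/((q+2)(q+3)) = 1/(q+2) - 1/(q+3). *)
Lemma luroth_le_cylinder q A : measurable A ->
  mu (Z @^-1` [set k | (k <= q)%N] `&` T @^-1` A) =
  ((1 - q.+2%:R^-1)%:E * mu A)%E.
Proof.
move=> mA; have mTA := measurable_preimage_map mA.
have mBfin : mu A \is a fin_num by rewrite fin_num_measure.
elim: q => [|q IH].
  rewrite (_ : [set k | _] = [set 0%N]).
    by rewrite luroth_cylinder// mul1n; congr (_%:E * _)%E; lra.
  by apply/seteqP; split => k /=; rewrite leqn0 => /eqP.
rewrite (_ : [set k | _] = [set k | (k <= q)%N] `|` [set q.+1]); last first.
  by apply/seteqP; split => k /=; lia.
rewrite preimage_setU setIUl measureU.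
- rewrite /= luroth_cylinder// IH -(fineK mBfin) -!EFinM -EFinD; congr EFin.
  rewrite -mulrDl; congr (_ * _); rewrite natrM -(natr1 q.+2).
  by field; rewrite !gt_eqF// ltr_pwDl.
- by apply: measurableI => //; exact: measurable_preimage_digit.
- by apply: measurableI => //; exact: measurable_preimage_digit.
- by rewrite -subset0 => x [[/= /[swap] _ + [/= + _]]]; lia.
Qed.

(** Complement of [luroth_le_cylinder] inside the preimage of [A], whose measure is known by
    invariance. The inequality [q <= k] is weak, whence 1/(q+1). *)
Lemma luroth_gt_cylinder q A : measurable A ->
  mu (Z @^-1` [set k | (q <= k)%N] `&` T @^-1` A) =
  (q.+1%:R^-1%:E * mu A)%E.
Proof.
move=> mA; have mTA := measurable_preimage_map mA.
case: q => [|q].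
  rewrite (_ : [set k | _] = setT) ?preimage_setT ?setTI; last exact/seteqP.
  by rewrite invr1 mul1e luroth_map_invariant.
have mBfin : mu A \is a fin_num by rewrite fin_num_measure.
have -> : Z @^-1` [set k | (q < k)%N] `&` T @^-1` A =
   T @^-1` A `\` (Z @^-1` [set k | (k <= q)%N] `&` T @^-1` A).
  apply/seteqP; split => x /=; rewrite ltnNge.
    by move=> [/negP h ?]; split => // -[].
  by move=> [? h]; split => //; apply/negP => ?; exact: h.
have mD : measurable (Z @^-1` [set k | (k <= q)%N] `&` T @^-1` A : set Omega).
  by apply: measurableI => //; exact: measurable_preimage_digit.
rewrite measureD// ?ltey_eq ?fin_num_measure//= setIidr; last exact: subIsetr.
rewrite luroth_le_cylinder// luroth_map_invariant//.
by rewrite -(fineK mBfin) -EFinM -EFinB; congr EFin; ring.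
Qed.

Definition digit j x := Z (iter j T x).

Lemma digitS j x : digit j.+1 x = digit j (T x).
Proof. by rewrite /digit iterSr. Qed.

Lemma measurable_digit j : measurable_fun [set: Omega] (digit j).
Proof.
elim: j => [|j IH]; first exact: measurable_luroth_digit.
rewrite (_ : digit _ = digit j \o T); last by apply/funext => x; exact: digitS.
exact: (measurableT_comp IH (@measurable_luroth_map R)).
Qed.

Definition digits_le n q : set Omega :=
  [set x | forall j, (j < n)%N -> (digit j x <= q)%N].

Lemma digits_le0 q : digits_le 0 q = setT.
Proof. by apply/seteqP; split. Qed.

Lemma digits_leS n q :
  digits_le n.+1 q = Z @^-1` [set k | (k <= q)%N] `&` T @^-1` (digits_le n q).
Proof.
apply/seteqP; split => x /=.
  by move=> h; split => [|j jn]; [exact: (h 0%N)|rewrite -digitS; exact: h].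
by move=> [h0 h] [|j]; [move=> _; exact: h0|rewrite digitS; exact: h].
Qed.

Lemma measurable_digits_le n q : measurable (digits_le n q).
Proof.
elim: n => [|n IH]; first by rewrite digits_le0.
rewrite digits_leS; apply: measurableI; first exact: measurable_preimage_digit.
exact: measurable_preimage_map.
Qed.

(** Peeling off the first digit contributes one factor at a time. *)
Lemma unif01_digits_le n q : mu (digits_le n q) = ((1 - q.+2%:R^-1) ^+ n)%:E.
Proof.
elim: n => [|n IH]; first by rewrite digits_le0 probability_setT.
rewrite digits_leS luroth_le_cylinder; last exact: measurable_digits_le.
by rewrite IH -EFinM exprS.
Qed.

Definition window_max n j x : nat := \max_(i < n) digit (j + i) x.

Lemma window_max_leP n j x q :
  reflect (forall i, (i < n)%N -> (digit (j + i) x <= q)%N)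
          (window_max n j x <= q)%N.
Proof.
apply: (iffP (bigmax_leqP _ _ _)) => h; last by move=> i _; exact: h.
by move=> i ni; exact: (h (Ordinal ni)).
Qed.

(** Shifting the window amounts to applying the measure-preserving map; stationarity rests on
    this. *)
Lemma window_maxS n j x : window_max n j.+1 x = window_max n j (T x).
Proof. by apply: eq_bigr => i _; rewrite addSn digitS. Qed.

Lemma measurable_window_max n j : measurable_fun [set: Omega] (window_max n j).
Proof.
rewrite /window_max; elim: n => [|n IH].
  rewrite (_ : (fun x => _) = cst 0%N); first exact: measurable_cst.
  by apply/funext => x; rewrite big_ord0.
under eq_fun do rewrite big_ord_recr/=.
by apply: measurable_fun_maxn => //; exact: measurable_digit.
Qed.

End iid.

(** * Elementary inequalities on powers *)

Section elementary.
Context {R : realFieldType}.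
Implicit Types (t b c g : R).

Lemma bernoulli_expr n t : 0 <= t <= 1 -> 1 - n%:R * t <= (1 - t) ^+ n.
Proof.
move=> t01; elim: n => [|n IH]; first by rewrite mul0r subr0.
rewrite exprS -natr1; have : 0 <= n%:R * t ^+ 2 by rewrite mulr_ge0 ?sqr_ge0.
by move: IH; set p := (1 - t) ^+ n; set N := n%:R; nra.
Qed.

Lemma bernoulli_expr_inv n t : 0 <= t <= 1 -> (1 - t) ^+ n * (1 + n%:R * t) <= 1.
Proof.
move=> t01; elim: n => [|n IH]; first by rewrite mul0r addr0 mulr1.
have p0 : 0 <= (1 - t) ^+ n by rewrite exprn_ge0//; lra.
apply: le_trans IH; rewrite exprSr -mulrA ler_wpM2l// -natr1.
by have : 0 <= n%:R :> R by []; nra.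
Qed.

(** A bound on the gap [g - b] relative to the tail [1 - g] passes to the powers with the same
    constant [c], so the estimate is uniform in [n]. *)
Lemma expr_sub_le n b c g : 0 <= b <= g -> g <= 1 -> g - b <= c * (1 - g) ->
  g ^+ n - b ^+ n <= c * (1 - g ^+ n).
Proof.
move=> bg g1 gb; elim: n => [|n IH]; first by rewrite !expr0 subrr mulr0.
have b0 : 0 <= b ^+ n <= 1 by rewrite exprn_ge0 ?exprn_ile1//; lra.
rewrite !exprS; move: IH b0; set p := g ^+ n; set q := b ^+ n => IH q01.
have -> : g * p - b * q = g * (p - q) + (g - b) * q by ring.
have -> : c * (1 - g * p) = g * (c * (1 - p)) + c * (1 - g) by ring.
apply: lerD; first by apply: ler_wpM2l => //; lra.
by apply: le_trans gb; rewrite ler_piMr//; lra.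
Qed.

(** Amounts to x(x+1) <= 2(x^2+1). It serves with [x] the minimal value [m] of the first digit, [y]
    a digit tail and [a] the tail of one term of the sequence. *)
Lemma ratio_bound (x y a : R) : 1 <= x -> 0 <= y ->
  (x ^+ 2 + 1) * y <= 2 * ((x + 1) * a) -> y * x <= 4 * a.
Proof.
move=> x1 y0 xa.
have a0 : 0 <= a.
  have : 0 <= (x ^+ 2 + 1) * y by rewrite mulr_ge0// addr_ge0// sqr_ge0.
  by move=> /le_trans/(_ xa); rewrite !pmulr_rge0//; lra.
have x2 : 0 < x ^+ 2 + 1 by rewrite ltr_wpDl// sqr_ge0.
rewrite -(ler_pM2l x2); have : x * ((x ^+ 2 + 1) * y) <= x * (2 * ((x + 1) * a)).
  by rewrite ler_wpM2l//; lra.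
have : 0 <= (x - 1) ^+ 2 * a by rewrite mulr_ge0// sqr_ge0.
have : 0 <= x ^+ 2 * a by rewrite mulr_ge0// sqr_ge0.
by nra.
Qed.

End elementary.

(** * Construction of the sequence as a mixture of moving maxima *)

Section mixed_max.
Context {R : realType}.
Local Notation Omega := (measurableTypeR R).
Implicit Types (x : R) (A B : set Omega).
Local Notation Z := (@luroth_digit R).
Local Notation T := (@luroth_map R).
Local Notation mu := (@unif01 R).

Definition offset (k : nat) : R := if k is 0 then 0 else 2^-1.

Definition component k (j : nat) x : R := (window_max (k ^ 2).+1 j x)%:R + offset k.

(** The windows are read from [T x], hence are independent of the digit [Z x] that selects their
    length. *)
Definition mixed_max j x : R := component (Z x) j (T x).

Lemma measurable_component k j : measurable_fun [set: Omega] (component k j).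
Proof.
apply: measurable_funD => //.
have mf : measurable_fun [set: nat] (fun n => n%:R : R) by [].
exact: (measurableT_comp mf (measurable_window_max _ _)).
Qed.

Lemma measurable_mixed_max j : measurable_fun [set: Omega] (mixed_max j : Omega -> R).
Proof.
rewrite (_ : setT = \bigcup_k Z @^-1` [set k]); last first.
  by rewrite -preimage_bigcup bigcup_imset1 image_id preimage_setT.
apply/measurable_fun_bigcup => k; first exact: measurable_preimage_digit.
apply: (eq_measurable_fun (component k j \o T)).
  by move=> x; rewrite inE/= => kx; rewrite /mixed_max kx.
apply: measurable_funTS; apply: measurableT_comp; first exact: measurable_component.
exact: measurable_luroth_map.
Qed.

Definition mixed_max_rv j : {RV mu >-> R} :=
  HB.pack_for {mfun Omega >-> R} (mixed_max j)
  (isMeasurableFun.Build _ _ Omega R (mixed_max j) (measurable_mixed_max j)).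

(** Good-sets principle: the sets of paths with measurable preimage form a sigma-algebra containing
    the cylinders. *)
Lemma measurable_path (Y : nat -> Omega -> R) (A : set (nat -> R)) :
  (forall j, measurable_fun [set: Omega] (Y j)) -> path_measurable A ->
  measurable ((fun x j => Y j x) @^-1` A : set Omega).
Proof.
move=> mY; rewrite /path_measurable => mA.
apply: (mA [set A | measurable ((fun x j => Y j x) @^-1` A : set Omega)]).
split => //=.
split => //=.
- by rewrite preimage_set0.
- by move=> C mC; rewrite setTD preimage_setC; exact: measurableC.
- by move=> F mF; rewrite preimage_bigcup; exact: bigcupT_measurable.
move=> _ /= [j [B [mB ->]]].
by rewrite -[X in measurable X]setTI; exact: mY.
Qed.

Local Notation X := mixed_max_rv.

(** * Stationarity and non-ergodicity *)

Lemma path_measurable_shift (A : set (nat -> R)) :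
  path_measurable A -> path_measurable (@path_shift R @^-1` A).
Proof.
move=> mA B [sB genB].
apply: (mA [set A | B (@path_shift R @^-1` A)]).
case: sB => B0 BC BU; split => /=.
  split => /=; first by rewrite preimage_set0.
    by move=> C /BC; rewrite !setTD preimage_setC.
  by move=> F /BU; rewrite preimage_bigcup.
move=> _ /= [j [C [mC ->]]].
by apply: genB; exists j.+1, C.
Qed.

(** Exhibits the law of the path as a mixture of the laws of the components. *)
Lemma mixed_max_slice k (A : set (nat -> R)) : path_measurable A ->
  mu (Z @^-1` [set k] `&` sample_path X @^-1` A) =
  ((k.+1 * k.+2)%:R^-1%:E * mu ((fun x j => component k j x) @^-1` A))%E.
Proof.
move=> mA; rewrite -luroth_cylinder; last first.
  by apply: measurable_path => // j; exact: measurable_component.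
congr (mu _); rewrite /sample_path; apply/seteqP.
by split => x /= [kx]; rewrite /sample_path/= /mixed_max kx.
Qed.

(** Each component is stationary, because its shifted path at [x] is its path at [T x] and [T]
    preserves the measure; a mixture inherits this. *)
Lemma stationary_mixed_max : stationary X.
Proof.
move=> A mA; have mSA := path_measurable_shift mA.
rewrite /path_law /= !unif01_slices; [|exact: measurable_path..].
apply: eq_eseriesr => k _; rewrite !mixed_max_slice//; congr (_ * _)%E.
rewrite -[RHS]luroth_map_invariant; last first.
  by apply: measurable_path => // j; exact: measurable_component.
congr (mu _); apply/funext => x; congr A; apply/funext => j.
by rewrite /path_shift /component window_maxS.
Qed.

Lemma natr_add_half_neq (m n : nat) : m%:R + 2^-1 <> n%:R :> R.
Proof.
have /orP[|] : (n <= m)%N || (m < n)%N by lia.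
  by rewrite -(ler_nat R) => ? ?; lra.
by rewrite -(ler_nat R) -natr1 => ? ?; lra.
Qed.

Lemma nonergodic_mixed_max : ~ ergodic X.
Proof.
pose N : set R := range (fun n : nat => n%:R).
(* Requiring integer values only eventually makes [A] equal to its preimage under the shift. *)
pose A := [set y : nat -> R | exists m, forall j, (m <= j)%N -> N (y j)].
have mA : path_measurable A.
  set G := [set C | exists j (B : set R),
    measurable B /\ C = [set x : nat -> R | B (x j)]].
  rewrite (_ : A = \bigcup_m \bigcap_(j in [set j | (m <= j)%N])
      [set y : nat -> R | N (y j)]).
    apply: (@bigcupT_measurable _ (g_sigma_algebraType G)) => m.
    apply: (@bigcap_measurable _ (g_sigma_algebraType G)); first by exists m => /=.
    move=> j _; apply: sub_sigma_algebra; exists j, N; split => //.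
    apply: countable_measurable => //.
    by apply: (sub_countable (card_image_le _ _)); exact: countableP.
  apply/seteqP; split => y /=; first by move=> [m h]; exists m.
  by move=> [m _ h]; exists m.
have SA : @path_shift R @^-1` A = A.
  apply/seteqP; split => y [m h].
    by exists m.+1 => -[//|j] mj; exact: h.
  by exists m => j mj; apply: h; rewrite (leq_trans mj).
move=> /(_ A mA SA); rewrite /path_law.
have -> : sample_path X @^-1` A = Z @^-1` [set 0%N].
  apply/seteqP; split => x /=.
    case kx : (Z x) => [//|k] [m /(_ m (leqnn m))] [n _].
    rewrite /sample_path/= /mixed_max kx /component/= => /esym.
    by move/natr_add_half_neq.
  move=> x0; exists 0%N => j _; rewrite /sample_path/= /mixed_max x0 /component/= addr0.
  by eexists.
have := @luroth_cylinder R 0 setT measurableT.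
rewrite preimage_setT setIT probability_setT mule1 mul1n /= => ->.
by case=> -[]; lra.
Qed.

(** * Bounds on the laws of the maximum and of one term by powers of the digit law *)

Lemma offset_ge0 k : 0 <= offset k :> R. Proof. by case: k => //= k; lra. Qed.

Lemma offset_le k : offset k <= 2^-1 :> R. Proof. by case: k => //= k; lra. Qed.

Lemma mixed_max_ge0 j x : 0 <= mixed_max j x.
Proof. by rewrite addr_ge0 ?offset_ge0. Qed.

Lemma mixed_max_le_digit i j x u : mixed_max j x <= u -> (i <= Z x ^ 2)%N ->
  (digit (j + i) (T x) <= Num.truncn u)%N.
Proof.
move=> pu ik; have u0 := le_trans (mixed_max_ge0 j x) pu.
apply: (@leq_trans (window_max (Z x ^ 2).+1 j (T x))).
  by have /window_max_leP := leqnn (window_max (Z x ^ 2).+1 j (T x)); exact.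
by rewrite truncn_ge_nat// (le_trans _ pu)// lerDl offset_ge0.
Qed.

(** Lowering the integer level by one absorbs the offset, which is at most 1/2; [1 <= u] makes the
    predecessor a true subtraction. *)
Lemma window_mixed_max_le j x u : 1 <= u ->
  (window_max (Z x ^ 2).+1 j (T x) <= (Num.truncn u).-1)%N -> mixed_max j x <= u.
Proof.
move=> u1 wq; have u0 : 0 <= u by lra.
have q0 : (0 < Num.truncn u)%N by rewrite truncn_gt0.
have : (window_max (Z x ^ 2).+1 j (T x)).+1%:R <= u.
  by rewrite -truncn_ge_nat// -(prednK q0).
rewrite -[_.+1%:R]natr1 => wu; have := offset_le (Z x).
by rewrite /mixed_max /component; lra.
Qed.

Lemma partial_max_le n u :
  [set x | partial_max X n.+1 x <= u] =
  \bigcap_(j in [set j | (j < n.+1)%N]) [set x | mixed_max j x <= u].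
Proof.
apply/seteqP; split => x /=.
  by move=> /bigmax_leP[_ h] j /= jn; exact: (h (Ordinal jn)).
move=> h; apply/bigmax_leP; split => [|j _]; first exact: (h 0%N).
by apply: (h j) => /=.
Qed.

Lemma measurable_mixed_max_le j u :
  measurable ([set x | mixed_max j x <= u] : set Omega).
Proof.
rewrite (_ : [set x | _] = setT `&` mixed_max j @^-1` `]-oo, u]); last first.
  by rewrite setTI; apply/seteqP; split => x /=; rewrite in_itv.
by apply: measurable_mixed_max => //; exact: measurable_itv.
Qed.

Lemma measurable_partial_max_le n u :
  measurable ([set x | partial_max X n.+1 x <= u] : set Omega).
Proof.
rewrite partial_max_le; apply: bigcap_measurable => [|j _]; first by exists 0%N.
exact: measurable_mixed_max_le.
Qed.

(** Each term dominates the first digit of its window, so the maximum dominates [n.+1] digits. *)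
Lemma max_cdf_le n u :
  max_cdf X n.+1 u <= (1 - (Num.truncn u).+2%:R^-1) ^+ n.+1.
Proof.
rewrite -lee_fin /max_cdf fineK ?fin_num_measure//; last exact: measurable_partial_max_le.
have mD := @measurable_digits_le R n.+1 (Num.truncn u).
rewrite -unif01_digits_le -[leRHS]luroth_map_invariant//.
apply: le_measure; rewrite ?inE.
- exact: measurable_partial_max_le.
- exact: measurable_preimage_map.
rewrite partial_max_le => x h j jn; rewrite -(addn0 j); apply: mixed_max_le_digit => //.
exact: h.
Qed.

Lemma max_cdf_lt0 n u : u < 0 -> max_cdf X n.+1 u = 0.
Proof.
move=> u0; rewrite /max_cdf partial_max_le (_ : \bigcap_(_ in _) _ = set0) ?measure0//.
apply/seteqP; split => // x /(_ 0%N (ltn0Sn _)) /=.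
by rewrite leNgt (lt_le_trans u0)// mixed_max_ge0.
Qed.

(** When the first digit is at most [K], of probability 1 - 1/(K+2), all the windows together lie in
    the first [n.+1 + K ^ 2] digits of [T x]. *)
Lemma max_cdf_ge n K u : 1 <= u ->
  (1 - K.+2%:R^-1) * (1 - (Num.truncn u).+1%:R^-1) ^+ (n.+1 + K ^ 2) <=
  max_cdf X n.+1 u.
Proof.
move=> u1.
rewrite -lee_fin /max_cdf fineK ?fin_num_measure//; last exact: measurable_partial_max_le.
have q0 : (0 < Num.truncn u)%N by rewrite truncn_gt0.
have mD := @measurable_digits_le R (n.+1 + K ^ 2) (Num.truncn u).-1.
have := @unif01_digits_le R (n.+1 + K ^ 2) (Num.truncn u).-1.
rewrite prednK// EFinM => <-; rewrite -luroth_le_cylinder//.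
apply: le_measure; rewrite ?inE; [|exact: measurable_partial_max_le|].
  by apply: measurableI; [exact: measurable_preimage_digit|exact: measurable_preimage_map].
rewrite partial_max_le => x [/= ZK h] j /= jn; apply: window_mixed_max_le => //.
apply/window_max_leP => i; rewrite ltnS => iZ; apply: h.
have : (Z x ^ 2 <= K ^ 2)%N by rewrite leq_exp2r.
by move: iZ jn; lia.
Qed.

(* On [m <= Z x] the window has at least m^2 + 1 digits, while this event has
   probability 1/(m + 1): letting m grow beats any multiple of the digit tail. *)
Lemma cdf_mixed_max_le m u :
  fine (cdf (X 0) u) <=
  1 - m.+1%:R^-1 * (1 - (1 - (Num.truncn u).+2%:R^-1) ^+ (m ^ 2).+1).
Proof.
have mF : measurable ([set x | mixed_max 0 x <= u] : set Omega).
  exact: measurable_mixed_max_le.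
have mD := @measurable_digits_le R (m ^ 2).+1 (Num.truncn u).
have -> : cdf (X 0) u = mu [set x | mixed_max 0 x <= u].
  by congr (mu _); apply/seteqP; split => x /=; rewrite in_itv.
have mE : measurable (Z @^-1` [set k | (m <= k)%N] `&`
    T @^-1` (~` digits_le (m ^ 2).+1 (Num.truncn u)) : set Omega).
  apply: measurableI; first exact: measurable_preimage_digit.
  by apply: measurable_preimage_map; exact: measurableC.
rewrite -lee_fin fineK ?fin_num_measure// EFinB EFinM EFinB -unif01_digits_le.
rewrite -probability_setC// -luroth_gt_cylinder; last exact: measurableC.
rewrite -probability_setC//; apply: le_measure; rewrite ?inE//; first exact: measurableC.
move=> x /= pu [/= mZ]; apply => j jm.
rewrite -[j]add0n; apply: mixed_max_le_digit pu _.
by apply: (@leq_trans (m ^ 2)) => //; rewrite leq_exp2r.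
Qed.

End mixed_max.

(** * The phantom distribution function and the extremal index 0 *)

Section phantom.
Context {R : realType}.
Implicit Types (u e : R).
Local Notation X := (@mixed_max_rv R).

(* A continuous interpolation of the distribution function
   q |-> 1 - 1/(q + 2) of a digit. *)
Definition phantom u : R := 1 - (Num.max u (-1) + 2)^-1.

Let den_ge1 u : 1 <= Num.max u (-1) + 2.
Proof. by rewrite -lerBlDr le_max; apply/orP; right; lra. Qed.

Let den_gt0 u : 0 < Num.max u (-1) + 2.
Proof. by have := den_ge1 u; lra. Qed.

Lemma phantomE u : -1 <= u -> phantom u = 1 - (u + 2)^-1.
Proof. by move=> u1; rewrite /phantom max_l. Qed.

Lemma phantom_nd : nondecreasing phantom.
Proof.
move=> u v uv; rewrite /phantom lerD2l lerN2 lef_pV2 ?posrE// lerD2r.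
by rewrite ge_max !le_max uv/= lexx orbT.
Qed.

Lemma phantom_continuous : continuous phantom.
Proof.
move=> u; apply: cvgB; first exact: cvg_cst.
apply: cvgV; first by rewrite gt_eqF.
apply: cvgD; last exact: cvg_cst.
by apply: (@continuous_max R R id (cst (-1))); [exact: cvg_id|exact: cvg_cst].
Qed.

Lemma phantom_Ny : phantom u @[u --> -oo] --> (0 : R).
Proof.
apply: cvg_near_cst; exists (-1); split => // u u1.
rewrite /phantom max_r ?ltW// (_ : -1 + 2 = 1); last by ring.
by rewrite invr1 subrr.
Qed.

Lemma phantom_y : phantom u @[u --> +oo] --> (1 : R).
Proof.
apply/cvgrPdist_le => e e0; exists (Num.max 0 e^-1); split => [|u]; first exact: num_real.
rewrite gt_max => /andP[u0 ue].
rewrite phantomE; last by lra.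
rewrite opprB addrC subrK ger0_norm ?invr_ge0; last by lra.
by rewrite invf_ple ?posrE//; lra.
Qed.

HB.instance Definition _ :=
  isCumulative.Build R _ R phantom phantom_nd (right_continuousW phantom_continuous).
HB.instance Definition _ :=
  isCumulativeBounded.Build R 0 1 phantom phantom_Ny phantom_y.

Definition phantom_df : cumulativeBounded (0 : R) (1 : R) := phantom.

Lemma phantom_ge0 u : 0 <= phantom u.
Proof. by rewrite subr_ge0 invf_le1. Qed.

Lemma phantom_lt1 u : phantom u < 1.
Proof. by rewrite ltrBlDr ltrDl invr_gt0. Qed.

Lemma max_cdf_ge0 n u : 0 <= max_cdf X n u. Proof. exact: fine_ge0. Qed.

Lemma max_cdf_le_phantom n u : max_cdf X n.+1 u <= phantom u ^+ n.+1.
Proof.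
have [u0|u0] := ltP u 0; first by rewrite max_cdf_lt0// exprn_ge0// phantom_ge0.
apply: le_trans (max_cdf_le n u) _.
have q0 : (Num.truncn u)%:R <= u by rewrite truncn_le.
rewrite lerXn2r ?nnegrE ?phantom_ge0//; first by rewrite subr_ge0 invf_le1// ler1n.
rewrite phantomE; last by lra.
by rewrite lerD2l lerN2 lef_pV2 ?posrE//; last lra; rewrite -addn2 natrD lerD2r.
Qed.

(** Three errors add up, none depending on [n]: 2/u for rounding and offset, K^2/u for the
    additional digits, and 1/(K+2) for long windows. *)
Lemma max_cdf_ge_phantom n K u : 1 <= u ->
  phantom u ^+ n.+1 - max_cdf X n.+1 u <= (2 + (K ^ 2)%:R) / u + K.+2%:R^-1.
Proof.
move=> u1; set N := n.+1; set b := 1 - u^-1; set c := K.+2%:R^-1 : R.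
have u0 : 0 < u by lra.
have iu0 : 0 < u^-1 by rewrite invr_gt0.
have iu1 : u^-1 <= 1 by rewrite invf_le1.
have c01 : 0 <= c <= 1 by rewrite invr_ge0 ler0n/= invf_le1// ler1n.
have b01 : 0 <= b <= 1 by rewrite /b; lra.
have Mb : b ^+ (N + K ^ 2) - c <= max_cdf X N u.
  apply: le_trans (max_cdf_ge n K u1).
  apply: (@le_trans _ _ ((1 - c) * b ^+ (N + K ^ 2))).
    have : 0 <= b ^+ (N + K ^ 2) <= 1 by rewrite exprn_ge0 ?exprn_ile1//; lra.
    by set p := b ^+ _; nra.
  rewrite ler_wpM2l//; first lra.
  have uq : u < (Num.truncn u).+1%:R by exact: truncnS_gt.
  have q1 : (Num.truncn u).+1%:R^-1 <= u^-1 by rewrite lef_pV2 ?posrE// ltW.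
  move: q1; set v := _.+1%:R^-1 => q1.
  by rewrite lerXn2r ?nnegrE// /b; lra.
have Gb : phantom u ^+ N - b ^+ N <= 2 / u.
  have uE := phantomE (ltac:(lra) : -1 <= u).
  have iu2 : (u + 2)^-1 <= u^-1 by rewrite lef_pV2 ?posrE//; lra.
  apply: (@le_trans _ _ (2 / u * (1 - phantom u ^+ N))); last first.
    rewrite ler_piMr ?divr_ge0//; first lra.
    by rewrite gerBl exprn_ge0// phantom_ge0.
  (* The constant 2/u is exact: 1/u - 1/(u+2) = (2/u) / (u+2). *)
  apply: expr_sub_le; rewrite ?(ltW (phantom_lt1 _))// uE /b; first lra.
  rewrite le_eqVlt; apply/orP; left; apply/eqP; field.
  by rewrite !gt_eqF//; lra.
have bK : 1 - (K ^ 2)%:R / u <= b ^+ (K ^ 2) by apply: bernoulli_expr; lra.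
have bN : 0 <= b ^+ N <= 1 by rewrite exprn_ge0 ?exprn_ile1//; lra.
have bb : b ^+ N - (K ^ 2)%:R / u <= b ^+ (N + K ^ 2).
  have : 0 <= (K ^ 2)%:R / u by rewrite divr_ge0// ltW.
  rewrite exprD; move: bK bN; set p := b ^+ N; set q := b ^+ _; set r := _ / u.
  by nra.
by rewrite mulrDl; lra.
Qed.

(** Levels are split at [u0]. Below it both quantities are at most [phantom u0 ^+ n], which tends to
    0; above it [max_cdf_ge_phantom] is uniform. *)
Lemma phantom_mixed_max : phantom_distribution_function X phantom_df.
Proof.
apply/cvgrPdist_le => e e0.
pose K := Num.truncn (2 / e).
(* Beyond [u0] the error (2 + K^2)/u is at most e/2; the summand 1 ensures [1 <= u]. *)
pose u0 := 1 + (2 + (K ^ 2)%:R) * 2 / e.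
have c0 : 0 <= (2 + (K ^ 2)%:R) * 2 / e.
  by rewrite divr_ge0 ?ltW// mulr_gt0// ltr_pwDl.
have /cvgrPdist_le/(_ _ e0) : phantom u0 ^+ n @[n --> \oo] --> (0 : R).
  by apply: cvg_expr; rewrite ger0_norm ?phantom_ge0 ?phantom_lt1.
apply: filter_app; near=> n.
have [m nE] : exists m, n = m.+1.
  by exists n.-1; rewrite prednK//; near: n; exact: nbhs_infty_gt.
rewrite sub0r normrN ger0_norm ?exprn_ge0 ?phantom_ge0// => Gn.
set E := [set _ | _ in _].
have E_le : ubound E e.
  move=> _ [u _ <-]; rewrite nE distrC ger0_norm ?subr_ge0 ?max_cdf_le_phantom//.
  have [uu0|uu0] := ltP u u0.
    apply: (@le_trans _ _ (phantom u ^+ m.+1)); first by rewrite gerBl max_cdf_ge0.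
    apply: le_trans Gn; rewrite nE lerXn2r ?nnegrE ?phantom_ge0//.
    by apply: phantom_nd; exact: ltW.
  have u1 : 1 <= u by move: c0 uu0; rewrite /u0; lra.
  apply: (le_trans (max_cdf_ge_phantom m K u1)).
  have : K.+2%:R^-1 <= e / 2.
    rewrite -[e / 2]invrK lef_pV2 ?posrE ?invr_gt0 ?divr_gt0// invf_div.
    by rewrite (le_trans (ltW (truncnS_gt _)))// ler_nat.
  have : (2 + (K ^ 2)%:R) / u <= e / 2.
    rewrite ler_pdivrMr; last by lra.
    have : (2 + (K ^ 2)%:R) * 2 / e <= u by move: uu0; rewrite /u0; lra.
    by rewrite ler_pdivrMr//; lra.
  by move=> h1 h2; rewrite [leRHS]splitr lerD.
have E0 : E !=set0 by eexists; exists 0.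
rewrite sub0r normrN ger0_norm; first exact: ge_sup.
have [x [u _ xE]] := E0.
apply: (@le_trans _ _ x); first by rewrite -xE.
by apply: ub_le_sup; [exists e|exists u].
Unshelve. all: by end_near.
Qed.

(** A digit tail is negligible against the tail of one term, by a factor 4/m with [m] free. The
    bound on [cdf] is made linear in the digit tail by [bernoulli_expr_inv]. *)
Lemma truncn_inv_le m u : (0 < m)%N ->
  m.+1%:R * (1 - fine (cdf (X 0) u)) <= 2^-1 ->
  (Num.truncn u).+2%:R^-1 <= 4 / m%:R * (1 - fine (cdf (X 0) u)).
Proof.
move=> m0; have := cdf_mixed_max_le m u.
set F := fine _; set d := _.+2%:R^-1; set M := (m ^ 2).+1 => FM s2.
have d01 : 0 <= d <= 1 by rewrite invr_ge0 ler0n/= invf_le1// ler1n.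
have := bernoulli_expr_inv M d01.
have m1 : 1 <= m%:R :> R by rewrite ler1n.
have {FM} : 1 - (1 - d) ^+ M <= m.+1%:R * (1 - F).
  by rewrite -ler_pdivrMl// lerBrDr addrC -lerBrDr.
have Md : 0 <= M%:R * d by rewrite mulr_ge0//; lra.
move: s2; set s := _ * (1 - F); set p := (1 - d) ^+ M => s2 ps pM.
(* From (1 - s)(1 + y) <= 1 follows y <= s/(1 - s), and s <= 1/2. *)
have {ps pM} : M%:R * d <= 2 * s.
  move: ps pM Md s2; move: (M%:R * d) p s => y p s ps pM y0 s2.
  have : 0 <= (p - (1 - s)) * (1 + y) by rewrite mulr_ge0//; lra.
  have : 0 <= (2^-1 - s) * y by rewrite mulr_ge0//; lra.
  by lra.
rewrite /s mulrAC ler_pdivlMr; last by lra.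
rewrite -[M%:R]natr1 -[m.+1%:R]natr1 natrX.
by apply: ratio_bound => //; lra.
Qed.

(** At a level where [n] times the tail of one term stays bounded, [n] times the digit tail is
    arbitrarily small, so the maximum of the digits rarely exceeds it. *)
Lemma extremal_index_mixed_max : extremal_index_zero X.
Proof.
move=> tau u tau0 cvg_tau; apply/cvgrPdist_le => e e0.
pose K := Num.truncn (2 / e).
(* Chosen so that the final error 32 tau/m is at most e/2; the shift by two gives [2 <= m], needed
   for [1 <= u n]. *)
pose m := (Num.truncn (64 * tau / e)).+2.
have m2 : 2 <= m%:R :> R by rewrite ler_nat.
have Ke : K.+2%:R^-1 <= e / 2.
  rewrite -[e / 2]invrK lef_pV2 ?posrE ?invr_gt0 ?divr_gt0// invf_div.
  by rewrite (le_trans (ltW (truncnS_gt _)))// ler_nat.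
have me : 32 * tau <= e / 2 * m%:R.
  have : 64 * tau / e <= m%:R.
    by rewrite (le_trans (ltW (truncnS_gt _)))// ler_nat.
  by rewrite ler_pdivrMr//; lra.
(* Taking [tau] itself as tolerance bounds [n] times the tail by 2 tau. *)
have /cvgrPdist_le/(_ _ tau0) := cvg_tau.
apply: filter_app; near=> n => na.
have n0 : 0 < n%:R :> R by rewrite ltr0n; near: n; exact: nbhs_infty_gt.
have nK : (K ^ 2)%:R <= n%:R :> R by rewrite ler_nat; near: n; exact: nbhs_infty_ge.
have nm : 4 * tau * m.+1%:R <= n%:R by near: n; exact: nbhs_infty_ger.
have [k nE] : exists k, n = k.+1 by exists n.-1; rewrite prednK// -(ltr0n R).
set a := 1 - fine (cdf (X 0) (u n)) in na *.
have {}na : n%:R * a <= 2 * tau.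
  by move: na; rewrite ler_norml => /andP[+ _]; lra.
have ma : m.+1%:R * a <= 2^-1.
  rewrite -(ler_pM2l n0) mulrCA (le_trans (ler_wpM2l _ na))//.
  by move: nm; lra.
set q := Num.truncn (u n).
have qa : q.+2%:R^-1 <= 4 / m%:R * a by exact: truncn_inv_le.
have a0 : 0 <= a by rewrite subr_ge0 -lee_fin fineK ?cdf_le1// fin_num_measure.
(* Otherwise the digit tail would be at least 1/2, forcing a tail [a] too large for [ma]. *)
have u1 : 1 <= u n.
  rewrite -truncn_gt0 lt0n; apply/negP => /eqP q0; move: qa; rewrite /q q0.
  rewrite mulrAC ler_pdivlMr; last by lra.
  have : 0 <= (m%:R - 2) * a by rewrite mulr_ge0//; lra.
  by move: ma; rewrite -natr1; lra.
have Mge := max_cdf_ge k K u1; rewrite -nE -/q in Mge.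
have q1 : q.+1%:R^-1 <= 2 * q.+2%:R^-1 :> R.
  rewrite -ler_pdivrMl// -invfM lef_pV2 ?posrE ?mulr_gt0//.
  by rewrite -natrM ler_nat mul2n -addnn addSnnS leq_addl.
(* One factor 2 comes from [K ^ 2 <= n], the other from replacing [q.+2] by [q.+1]. *)
have qb : (n + K ^ 2)%:R * q.+1%:R^-1 <= e / 2.
  apply: (@le_trans _ _ (2 * n%:R * (2 * (4 / m%:R * a)))).
    apply: ler_pM => //; first by rewrite natrD; lra.
    by rewrite (le_trans q1)// ler_pM2l.
  rewrite (_ : _ * _ = 16 * (n%:R * a) / m%:R); last by ring.
  by rewrite ler_pdivrMr; lra.
have c01 : 0 <= (K.+2%:R^-1 : R) <= 1 by rewrite invr_ge0 ler0n/= invf_le1// ler1n.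
have b01 : 0 <= (q.+1%:R^-1 : R) <= 1 by rewrite invr_ge0 ler0n/= invf_le1// ler1n.
move: b01 qb Mge {q1}; set b : R := q.+1%:R^-1 => b01 qb Mge.
have := bernoulli_expr (n + K ^ 2) b01.
have : 0 <= (1 - b) ^+ (n + K ^ 2) <= 1.
  by rewrite exprn_ge0 ?exprn_ile1//; lra.
have max1 : max_cdf X n (u n) <= 1.
  rewrite nE (le_trans (max_cdf_le_phantom _ _))// exprn_ile1 ?phantom_ge0//.
  exact/ltW/phantom_lt1.
rewrite ger0_norm ?subr_ge0//.
move: Mge c01 Ke qb; set p := (1 - _) ^+ _; set c := K.+2%:R^-1.
set y := _ * b => Mge c01 Ke qb p01 yp.
have : 0 <= c * (1 - p) by rewrite mulr_ge0//; lra.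
have : c * p <= c by rewrite ler_piMr//; lra.
by move: Mge; rewrite mulrBl mul1r; lra.
Unshelve. all: by end_near.
Qed.

End phantom.

Theorem theorem2p10 (R : realType) :
  exists (d : measure_display) (T : measurableType d) (P : probability T R)
         (X : nat -> {RV P >-> R}),
    [/\ stationary X,
        exists G : cumulativeBounded (0 : R) (1 : R),
          continuous G /\ phantom_distribution_function X G,
        extremal_index_zero X
      & ~ ergodic X].
Proof.
exists _, (measurableTypeR R), unif01, (@mixed_max_rv R); split.
- exact: stationary_mixed_max.
- by exists phantom_df; split; [exact: phantom_continuous|exact: phantom_mixed_max].
- exact: extremal_index_mixed_max.
- exact: nonergodic_mixed_max.
Qed.
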